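(* The proof system $\mathbf{M}^\circ$ is sound and strongly complete with respect to the class of $(m)$-frames.
   Context: Fix a nonempty set $\mathbf{P}$ of propositional variables, $p\in\mathbf{P}$. $\mathcal{L}(\bullet)$: $\varphi::=p\mid\neg\varphi\mid\varphi\land\varphi\mid\bullet\varphi$; other Boolean connectives are defined as usual and $\circ\varphi$ abbreviates $\neg\bullet\varphi$. A neighborhood frame is $\langle S,N\rangle$ with $S$ a nonempty set and $N:S\to\mathcal{P}(\mathcal{P}(S))$; a model $\mathcal{M}=\langle S,N,V\rangle$ based on it adds $V:\mathbf{P}\to\mathcal{P}(S)$. With $\varphi^{\mathcal{M}}=\{s\in S\mid\mathcal{M},s\vDash\varphi\}$: $\mathcal{M},s\vDash p$ iff $s\in V(p)$; Boolean connectives as usual; $\mathcal{M},s\vDash\bullet\varphi$ iff $s\in\varphi^{\mathcal{M}}$ and $\varphi^{\mathcal{M}}\notin N(s)$. An $(m)$-frame is one where, for all $s\in S$, $X\in N(s)$ and $X\subseteq Y\subseteq S$ imply $Y\in N(s)$. The proof system $\mathbf{M}^\circ$ for $\mathcal{L}(\bullet)$ has as axioms all instances of propositional tautologies and all instances of $\circ\texttt{E}$: $\bullet\varphi\to\varphi$ and $\circ\texttt{M}$: $\circ\varphi\land\varphi\to\circ(\varphi\lor\psi)$; its rules are modus ponens and $\texttt{RE}\circ$: from $\varphi\leftrightarrow\psi$ infer $\circ\varphi\leftrightarrow\circ\psi$ (applied to theorems). Sound with respect to a class of frames: every theorem is true at every state of every model based on a frame in the class. Strongly complete: for every set $\Gamma\cup\{\varphi\}$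 of formulas, if $\varphi$ is true at every state, in every model based on a frame in the class, at which all of $\Gamma$ is true, then $\vdash\bigwedge\Gamma_0\to\varphi$ for some finite $\Gamma_0\subseteq\Gamma$ (equivalently, every consistent set is satisfiable in a model based on a frame in the class). *)

(* Defs.v *)
From Stdlib Require List.
From mathcomp Require Import all_boot.
From mathcomp Require Import boolp classical_sets.
Set Implicit Arguments.
Unset Strict Implicit.
Unset Printing Implicit Defensive.
Local Open Scope classical_set_scope.

Inductive form (P : Type) : Type :=
| Var of P
| Neg of form P
| And of form P & form P
| Bullet of form P.

Definition Or P (f g : form P) : form P := Neg (And (Neg f) (Neg g)).
Definition Imp P (f g : form P) : form P := Neg (And f (Neg g)).
Definition Iff P (f g : form P) : form P := And (Imp f g) (Imp g f).
Definition Circ P (f : form P) : form P := Neg (Bullet f).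

(* The language has no constant for truth, so the empty conjunction is
   expressed with the help of a chosen variable [p0]. *)
Definition Top P (p0 : P) : form P := Or (Var p0) (Neg (Var p0)).
Definition BigAnd P (p0 : P) (l : seq (form P)) : form P :=
  foldr (@And P) (Top p0) l.

Record frame : Type := Frame {
  state : Type;
  state_nonempty : inhabited state;
  nbhd : state -> set (set state) }.

Record model (P : Type) : Type := Model {
  base : frame;
  val : P -> set (state base) }.

Fixpoint sat P (M : model P) (s : state (base M)) (f : form P) : Prop :=
  match f with
  | Var p => val p s
  | Neg g => ~ sat s g
  | And g h => sat s g /\ sat s h
  | Bullet g => sat s g /\ ~ nbhd s [set t | sat t g]
  end.

Definition m_frame (F : frame) : Prop :=
  forall (s : state F) (X Y : set (state F)), nbhd s X -> X `<=` Y -> nbhd s Y.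

(* Purely propositional formulas over countably many schematic letters.  The
   letters are not taken from [P]: when [P] is finite, tautologies over [P]
   would not have enough instances. *)
Inductive pform : Type :=
| PVar of nat
| PNeg of pform
| PAnd of pform & pform.

Fixpoint peval (v : nat -> bool) (a : pform) : bool :=
  match a with
  | PVar n => v n
  | PNeg b => ~~ peval v b
  | PAnd b c => peval v b && peval v c
  end.

Definition tautology (a : pform) : Prop := forall v : nat -> bool, peval v a.

Fixpoint psubst P (sigma : nat -> form P) (a : pform) : form P :=
  match a with
  | PVar n => sigma n
  | PNeg b => Neg (psubst sigma b)
  | PAnd b c => And (psubst sigma b) (psubst sigma c)
  end.

Inductive Mcirc (P : Type) : form P -> Prop :=
| Mcirc_taut (a : pform) (sigma : nat -> form P) :
    tautology a -> Mcirc (psubst sigma a)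
| Mcirc_E (f : form P) : Mcirc (Imp (Bullet f) f)
| Mcirc_M (f g : form P) : Mcirc (Imp (And (Circ f) f) (Circ (Or f g)))
| Mcirc_MP (f g : form P) : Mcirc (Imp f g) -> Mcirc f -> Mcirc g
| Mcirc_RE (f g : form P) : Mcirc (Iff f g) -> Mcirc (Iff (Circ f) (Circ g)).

(* A proof system is represented by its set [L] of theorems, and a class of
   frames by a predicate [C]. *)
Definition sound P (L : set (form P)) (C : frame -> Prop) : Prop :=
  forall f : form P, L f ->
  forall M : model P, C (base M) -> forall s : state (base M), sat s f.

Definition consequence P (C : frame -> Prop) (Gamma : set (form P)) (f : form P) :
    Prop :=
  forall M : model P, C (base M) -> forall s : state (base M),
    (forall g, Gamma g -> sat s g) -> sat s f.

Definition strongly_complete P (p0 : P) (L : set (form P)) (C : frame -> Prop) :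
    Prop :=
  forall (Gamma : set (form P)) (f : form P), consequence C Gamma f ->
  exists l : seq (form P),
    (forall g, List.In g l -> Gamma g) /\ L (Imp (BigAnd p0 l) f).

(* Main.v *)
Require Import Defs.
From Stdlib Require List.
From mathcomp Require Import all_boot.
From mathcomp Require Import boolp classical_sets filter.
Set Implicit Arguments.
Unset Strict Implicit.
Unset Printing Implicit Defensive.
Local Open Scope classical_set_scope.

(** Completeness is by a canonical model whose states are the truth assignments
    to formulas that commute with the Boolean connectives and make every theorem
    true; they play the role of maximal consistent sets.  A set [X] of states is
    a neighborhood of [w] when it contains the extension of some formula [h] with
    [w] making both [Circ h] and [h] true.  This family is closed under supersets
    by construction, and axiom M with rule RE shows that it contains the extension
    of a formula [f] true at [w] only if [w] makes [Circ f] true.  Extending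
    consistent sets to states is propositional compactness, obtained from an
    ultraproduct of assignments. *)

(** Variables and [Bullet] formulas are left unconstrained, so they behave as independent
    propositional atoms. *)
Definition boolean P (w : set (form P)) : Prop :=
  (forall f, w (Neg f) <-> ~ w f) /\ (forall f g, w (And f g) <-> w f /\ w g).

Section Boolean.
Variables (P : Type) (w : set (form P)).
Hypothesis bw : boolean w.

Lemma boolean_Neg f : w (Neg f) <-> ~ w f.
Proof. by case: bw. Qed.

Lemma boolean_And f g : w (And f g) <-> w f /\ w g.
Proof. by case: bw. Qed.

Lemma boolean_Or f g : w (Or f g) <-> w f \/ w g.
Proof.
rewrite /Or boolean_Neg boolean_And !boolean_Neg.
by case: (pselect (w f)); case: (pselect (w g)); tauto.
Qed.

Lemma boolean_Imp f g : w (Imp f g) <-> (w f -> w g).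
Proof.
rewrite /Imp boolean_Neg boolean_And boolean_Neg.
by case: (pselect (w g)); tauto.
Qed.

Lemma boolean_Iff f g : w (Iff f g) <-> (w f <-> w g).
Proof. by rewrite /Iff boolean_And !boolean_Imp; tauto. Qed.

Lemma boolean_BigAnd p0 l : w (BigAnd p0 l) <-> forall g, List.In g l -> w g.
Proof.
elim: l => [|f l IH] /=.
  by rewrite boolean_Or boolean_Neg; split=> // _; exact: EM.
rewrite boolean_And IH; split=> [[wf wl] g [<-//|/wl//]|wfl].
by split=> [|g gl]; apply: wfl; [left | right].
Qed.

Lemma boolean_psubst sigma a :
  w (psubst sigma a) <-> peval (fun n => `[< w (sigma n) >]) a.
Proof.
elim: a => [n|b IH|b IHb c IHc] /=.
- by split=> /asboolP.
- by rewrite boolean_Neg IH; split=> /negP.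
- by rewrite boolean_And IHb IHc; split=> /andP.
Qed.

End Boolean.

Lemma sat_boolean P (M : model P) (s : state (base M)) : boolean (@sat P M s).
Proof. by []. Qed.

Lemma Mcirc_sound P : sound (@Mcirc P) m_frame.
Proof.
move=> f; elim=> {f} [a sigma ta|f|f g|f g _ IHfg _ IHf|f g _ IH] M mM s.
- by apply/(boolean_psubst (sat_boolean s)); exact: ta.
- by apply/(boolean_Imp (sat_boolean s)) => /= -[].
- apply/(boolean_Imp (sat_boolean s)) => -[/= Cf sf] -[_]; apply.
  (* Truth of [Circ f] and [f] at [s] makes the extension of [f] a neighborhood; monotonicity passes
     this on to the larger extension of [Or f g]. *)
  apply: (mM s [set t | sat t f]); first by apply: contrapT => Nf; apply: Cf.
  by move=> t /= tf -[].
- by have /(boolean_Imp (sat_boolean s)) := IHfg M mM s; apply; exact: IHf.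
- have E (t : state (base M)) : sat t f <-> sat t g.
    by apply/(boolean_Iff (sat_boolean t)); exact: IH.
  apply/(boolean_Iff (sat_boolean s)) => /=.
  have -> : [set t : state (base M) | sat t g] = [set t | sat t f].
    by apply/seteqP; split=> t /E.
  by rewrite E.
Qed.

Fixpoint atoms P (f : form P) : seq (form P) :=
  match f with
  | Neg g => atoms g
  | And g h => atoms g ++ atoms h
  | a => [:: a]
  end.

Fixpoint skeleton P (letter : form P -> nat) (f : form P) : pform :=
  match f with
  | Neg g => PNeg (skeleton letter g)
  | And g h => PAnd (skeleton letter g) (skeleton letter h)
  | a => PVar (letter a)
  end.

Lemma psubst_skeleton P (letter : form P -> nat) (sigma : nat -> form P) f :
  (forall a, List.In a (atoms f) -> sigma (letter a) = a) ->
  psubst sigma (skeleton letter f) = f.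
Proof.
elim: f => [p|f IH|f IHf g IHg|f IH] /= lK.
- by apply: lK; left.
- by rewrite IH.
- by rewrite IHf ?IHg// => a al; apply: lK; apply/List.in_app_iff; tauto.
- by apply: lK; left.
Qed.

Lemma boolean_skeleton P (letter : form P -> nat) v :
  boolean [set f | peval v (skeleton letter f)].
Proof. by split=> [f|f g] /=; [split=> /negP | split=> /andP]. Qed.

(** With positions in the finite list [atoms f] as letters, [f] is a substitution instance of its
    skeleton, and each valuation of letters induces a Boolean assignment. Propositional derivations
    thus reduce to semantic checks. *)
Lemma Mcirc_valid P (f : form P) : (forall w, boolean w -> w f) -> Mcirc f.
Proof.
move=> vf.
have /choice [letter lK] : forall a, exists n,
    List.In a (atoms f) -> List.nth n (atoms f) f = a.
  move=> a; have [al|nal] := pselect (List.In a (atoms f)); last by exists 0%N.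
  by have [n [_ na]] := List.In_nth _ _ f al; exists n.
rewrite -(psubst_skeleton (sigma := fun n => List.nth n (atoms f) f) lK).
by apply: Mcirc_taut => v; exact: (vf _ (boolean_skeleton letter v)).
Qed.

Lemma Mcirc_BigAnd P (p0 : P) l :
  (forall g, List.In g l -> Mcirc g) -> Mcirc (BigAnd p0 l).
Proof.
elim: l => [|f l IH] /= Ll.
  by apply: Mcirc_valid => w bw; apply/(boolean_BigAnd bw p0 [::]).
have Lf : Mcirc f by apply: Ll; left.
have {IH}LB : Mcirc (BigAnd p0 l) by apply: IH => g gl; apply: Ll; right.
apply: Mcirc_MP LB; apply: Mcirc_MP Lf; apply: Mcirc_valid => w bw.
by rewrite !(boolean_Imp bw) (boolean_And bw).
Qed.

Lemma boolean_compact P (A : set (form P)) :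
  (forall l, (forall g, List.In g l -> A g) ->
     exists2 w, boolean w & forall g, List.In g l -> w g) ->
  exists2 w, boolean w & A `<=` w.
Proof.
move=> finA.
pose inA (l : seq (form P)) := forall g, List.In g l -> A g.
have [w0 bw0 _] := finA [::] (fun g => False_ind _).
have /choice [W WP] : forall l, exists w : set (form P),
    boolean w /\ (inA l -> forall g, List.In g l -> w g).
  move=> l; have [lA|nlA] := pselect (inA l); last by exists w0.
  by have [w bw wl] := finA l lA; exists w.
(* The filter on finite lists generated by the cones of lists from [A] that extend a given one. *)
pose F : set_system (seq (form P)) := [set S | exists2 l0, inA l0 &
  forall l, inA l -> List.incl l0 l -> S l].
have FF : ProperFilter F.
  split; first by move=> [l0 l0A /(_ l0 l0A)]; apply; exact: List.incl_refl.
  split.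
  - by exists [::].
  - move=> S T [l1 l1A Sl] [l2 l2A Tl]; exists (l1 ++ l2).
      by move=> g /List.in_app_iff [/l1A|/l2A].
    move=> l lA /List.incl_app_inv [l1l l2l].
    by split; [exact: Sl | exact: Tl].
  - by move=> S T ST [l0 l0A Sl]; exists l0 => // l lA l0l; apply: ST; exact: Sl.
have [U [UU FU]] := ultraFilterLemma FF.
(* A formula is true in the ultraproduct when [U]-almost all assignments [W l] make it true. *)
exists [set f | U [set l | W l f]].
  split=> [f|f g] /=; split.
  - move=> Unf Uf; apply: (@filter_not_empty _ U _).
    apply: filterS (filterI Uf Unf) => l [/= wf].
    by rewrite (boolean_Neg (WP l).1).
  - move=> nUf; have [//|] := in_ultra_setVsetC [set l | W l f] UU.
    by apply: filterS => l /=; rewrite (boolean_Neg (WP l).1).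
  - by move=> Ufg; split; apply: filterS Ufg => l /(boolean_And (WP l).1) [].
  - move=> [Uf Ug]; apply: filterS (filterI Uf Ug) => l /=.
    by rewrite (boolean_And (WP l).1).
move=> f Af; apply: FU; exists [:: f]; first by move=> g [<-|[]].
by move=> l lA fl; apply: (WP l).2 => //; apply: fl; left.
Qed.

Lemma split_list T (A B : set T) (l : seq T) :
  (forall x, List.In x l -> A x \/ B x) ->
  exists l1 l2, [/\ forall x, List.In x l1 -> A x,
    forall x, List.In x l2 -> B x &
    forall x, List.In x l -> List.In x l1 \/ List.In x l2].
Proof.
elim: l => [|x l IH] lAB; first by exists [::], [::].
have [|l1 [l2 [l1A l2B ll]]] := IH; first by move=> y yl; apply: lAB; right.
have [Ax|Bx] : A x \/ B x by apply: lAB; left.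
- exists (x :: l1), l2; split=> // y /=; first by case=> [<-|/l1A].
  by case=> [|/ll]; tauto.
- exists l1, (x :: l2); split=> // y /=; first by case=> [<-|/l2B].
  by case=> [|/ll]; tauto.
Qed.

(** Without such a derivation, the theorems, [Gamma] and [Neg f] would be finitely satisfiable, and
    compactness would yield an assignment refuting the hypothesis. *)
Lemma Mcirc_deduce P (p0 : P) (Gamma : set (form P)) (f : form P) :
  (forall w, boolean w -> @Mcirc P `<=` w -> Gamma `<=` w -> w f) ->
  exists l : seq (form P),
    (forall g, List.In g l -> Gamma g) /\ Mcirc (Imp (BigAnd p0 l) f).
Proof.
move=> Gf; apply: contrapT => nder.
have [] := @boolean_compact P (@Mcirc P `|` (Gamma `|` [set Neg f])); last first.
  move=> w bw wA; have : w (Neg f) by apply: wA; right; right.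
  rewrite (boolean_Neg bw); apply; apply: Gf => // g gA; apply: wA.
  - by left.
  - by right; left.
move=> l /split_list [l1 [l' [l1L l'A ll]]]; apply: contrapT => nw.
have [l2 [l3 [l2G l3f l'l]]] := split_list l'A.
apply: nder; exists l2; split=> //.
(* The theorems in [l1] are discharged by modus ponens; what remains is propositionally valid
   because [l] is unsatisfiable. *)
apply: Mcirc_MP (Mcirc_BigAnd p0 l1L); apply: Mcirc_valid => w bw.
rewrite !(boolean_Imp bw) !(boolean_BigAnd bw) => wl1 wl2.
apply: contrapT => nwf; apply: nw; exists w => // g /ll [/wl1//|].
by move=> /l'l [/wl2//|/l3f ->]; rewrite (boolean_Neg bw).
Qed.

Definition world P : Type := {w : set (form P) | boolean w /\ @Mcirc P `<=` w}.

Definition canonical_nbhd P (w : world P) : set (set (world P)) :=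
  [set X | exists h, [/\ sval w (Circ h), sval w h &
    [set u : world P | sval u h] `<=` X]].

(** [ne] is a parameter so that completeness can supply it from the world at hand. *)
Definition canonical_model P (ne : inhabited (world P)) : model P :=
  @Model P (Frame ne (@canonical_nbhd P)) (fun p => [set w | sval w (Var p)]).

Lemma canonical_m_frame P (ne : inhabited (world P)) :
  m_frame (base (canonical_model ne)).
Proof.
move=> w X Y [h [wCh wh hX]] XY; exists h; split=> //.
exact: subset_trans hX XY.
Qed.

Lemma Mcirc_world P (p0 : P) (f : form P) :
  (forall w : world P, sval w f) -> Mcirc f.
Proof.
move=> vf; have [|l [l0 Lf]] := @Mcirc_deduce P p0 set0 f.
  by move=> w bw Lw _; exact: (vf (exist _ w (conj bw Lw))).
by apply: Mcirc_MP Lf _; apply: Mcirc_BigAnd => g /l0.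
Qed.

(** The inclusion of extensions makes [Or h f] and [f] provably equivalent, so RE turns the
    [Circ (Or h f)] given by axiom M into [Circ f]. *)
Lemma world_Circ_mono P (p0 : P) (w : world P) (h f : form P) :
  (forall u : world P, sval u h -> sval u f) ->
  sval w (Circ h) -> sval w h -> sval w (Circ f).
Proof.
move=> hf; case: w => w [bw Lw] /= wCh wh.
have RE : Mcirc (Iff (Circ (Or h f)) (Circ f)).
  apply: Mcirc_RE; apply: Mcirc_world p0 _ _ => u; have bu := (svalP u).1.
  by rewrite (boolean_Iff bu) (boolean_Or bu); have := hf u; tauto.
have /(boolean_Iff bw) [wCC _] := Lw _ RE; apply: wCC.
have := Lw _ (Mcirc_M h f); rewrite (boolean_Imp bw); apply.
exact/(boolean_And bw).
Qed.

Lemma truth_lemma P (p0 : P) (ne : inhabited (world P)) (f : form P) :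
  forall w : state (base (canonical_model ne)), sat w f <-> sval w f.
Proof.
elim: f => [p|f IH|f IHf g IHg|f IH] w //=.
- by rewrite IH (boolean_Neg (svalP w).1).
- by rewrite IHf IHg (boolean_And (svalP w).1).
have -> : [set t : world P | @sat P (canonical_model ne) t f] =
    [set t | sval t f] by apply/seteqP; split=> t /IH.
have [bw Lw] := svalP w; rewrite IH; split.
(* If [Bullet f] failed, [f] itself would witness that its extension is a neighborhood. *)
- move=> [wf nN]; apply: contrapT => /(boolean_Neg bw) wCf.
  by apply: nN; exists f; split.
- move=> wBf; split.
    by have := Lw _ (Mcirc_E f); rewrite (boolean_Imp bw); apply.
  move=> [h [wCh wh hf]].
  by have /(boolean_Neg bw) := world_Circ_mono p0 hf wCh wh.
Qed.

Lemma Mcirc_strongly_complete P (p0 : P) :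
  strongly_complete p0 (@Mcirc P) m_frame.
Proof.
move=> Gamma f Gf; apply: Mcirc_deduce => w bw Lw Gw.
pose u : world P := exist _ w (conj bw Lw).
have uP g := @truth_lemma P p0 (inhabits u) g u.
apply: (uP f).1.
apply: Gf; first exact: canonical_m_frame.
by move=> g /Gw wg; exact: (uP g).2.
Qed.

Theorem theorem5p12 (P : Type) (p0 : P) :
  sound (@Mcirc P) m_frame /\ strongly_complete p0 (@Mcirc P) m_frame.
Proof. by split; [exact: Mcirc_sound | exact: Mcirc_strongly_complete]. Qed.
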